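(* Let $C$ be the Cauchy--Green strain tensor field of a smooth two-dimensional flow map on $U\subset\mathbb{R}^2$, and let $D=\tfrac12(C\Omega-\Omega C)$ and $g(u,v)=\langle u,D(x_0)v\rangle$ be as in the context. Then: (i) every perfect shearless barrier is a null-geodesic of $g$; (ii) every null-geodesic of $g$ is composed of tensorlines of $C$. That is, if $r:[0,\sigma]\to U$ is a parametrization of such a curve with $r'(s)\neq 0$ for all $s$, then on each subinterval of $[0,\sigma]$ along which $\lambda_1(r(s))\neq\lambda_2(r(s))$, either $r'(s)\parallel\xi_1(r(s))$ for all $s$ in the subinterval, or $r'(s)\parallel\xi_2(r(s))$ for all $s$ in the subinterval. In particular, perfect shearless barriers are composed of tensorlines of $C$.
   Context: Setting. $U\subset\mathbb{R}^2$ is open, $F=F_{t_0}^{t}$ is the smooth flow map, from time $t_0$ to time $t$, of a smooth time-dependent planar velocity field, and $\langle\cdot,\cdot\rangle$ is the Euclidean inner product. The right Cauchy--Green strain tensor is $C(x_0)=[\nabla F(x_0)]^{T}\nabla F(x_0)$, a smooth field of symmetric positive definite $2\times 2$ matrices on $U$. Its eigenvalues are $0<\lambda_1(x_0)\le\lambda_2(x_0)$, with orthonormal eigenvectors $\xi_1(x_0)\perp\xi_2(x_0)$, $C\xi_i=\lambda_i\xi_i$. The eigenvectors are well defined up to sign where $\lambda_1\ne\lambda_2$; the points where $\lambda_1=\lambda_2$ are the Cauchy--Green singularities (for an incompressible flow these are the points where $C=I$). Tensorlines of $C$ are curves everywhere tangent to $\xi_1$ (strainlines) or everywhere tangent to $\xi_2$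 (stretchlines). Put $\Omega=\begin{pmatrix}0&-1\\1&0\end{pmatrix}$ and $D(x_0)=\tfrac12\,[C(x_0)\Omega-\Omega C(x_0)]$, which is symmetric. The metric $g(u,v)=\langle u,D(x_0)v\rangle$ is Lorentzian, of signature $(-,+)$, away from the Cauchy--Green singularities, and $D$ vanishes at the singularities. Curves $\gamma$ are given by smooth parametrizations $r:[0,\sigma]\to U$ with $r'(s)\neq0$. The Lagrangian shear along $\gamma$ is $$p(r,r')=\frac{\langle r',D(r)r'\rangle}{\sqrt{\langle r',C(r)r'\rangle\,\langle r',r'\rangle}},$$ and the averaged Lagrangian shear is $P(\gamma)=\frac1\sigma\int_0^\sigma p(r(s),r'(s))\,ds$. A perfect shearless barrier is a stationary curve of $P$, i.e. a solution $r(s)$ of the Euler--Lagrange equation $\partial_r p-\frac{d}{ds}\partial_{r'}p=0$ on $[0,\sigma]$, whose shear vanishes pointwise: $p(r(s),r'(s))=0$ for all $s\in[0,\sigma]$. A null-geodesic of $g$ is a curve that, after a smooth regular reparametrization $r(\tau)$ (with dot denoting $d/d\tau$), satisfies the Euler--Lagrange equation of the Lagrangian $H_0(r,\dot r)=\langle\dot r,D(r)\dot r\rangle$, namely $\partial_r H_0-\frac{d}{d\tau}\partial_{\dot r}H_0=0$, together with $\langle\dot r(\tau),D(r(\tau))\dot r(\tau)\rangle=0$ for all $\tau$. *)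

(* Defs.v *)
(* Planar Lagrangian shear barriers, in MathComp-Analysis over R : realType.
   Points and vectors of the plane are column vectors, and matrices act on
   them by left multiplication, as in the usual formulas. *)
From HB Require Import structures.
From mathcomp Require Import all_boot all_order all_algebra.
From mathcomp Require Import all_classical all_reals all_analysis.

Set Implicit Arguments.
Unset Strict Implicit.
Unset Printing Implicit Defensive.

Import Order.TTheory GRing.Theory Num.Theory.
Import numFieldNormedType.Exports.

Local Open Scope classical_set_scope.
Local Open Scope ring_scope.

(* All directional derivatives up to order n exist on A and are continuous
   there. For V finite-dimensional and A open this is the usual class C^n:
   every iterated partial derivative is an iterated directional derivative,
   and continuity of the partial derivatives gives Frechet differentiability. *)
Fixpoint Ck (R : realType) (V W : normedModType R) (n : nat)
    (A : set V) (f : V -> W) : Prop :=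
  match n with
  | 0%N => forall x, A x -> {for x, continuous f}
  | n'.+1 => (forall x v, A x -> derivable f x v) /\
             (forall v, Ck n' A (fun x => 'D_v f x))
  end.

Definition smooth_on (R : realType) (V W : normedModType R)
    (A : set V) (f : V -> W) : Prop :=
  forall n, Ck n A f.

(* On a set that need not be open (such as [0, sigma]) a function is smooth
   when it is smooth on an open neighbourhood of that set. Derivatives at the
   endpoints of a closed interval are then determined by the values of f on the
   interval, so the two-sided derivatives below agree with the one-sided ones. *)
Definition smooth_around (R : realType) (V W : normedModType R)
    (A : set V) (f : V -> W) : Prop :=
  exists B : set V, [/\ open B, A `<=` B & smooth_on B f].

Definition inner (R : realType) (u v : 'cV[R]_2) : R := (u^T *m v) 0 0.

Definition basis_vec (R : realType) (j : 'I_2) : 'cV[R]_2 := delta_mx j 0.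

Definition grad (R : realType) (f : 'cV[R]_2 -> R) (x : 'cV[R]_2) : 'cV[R]_2 :=
  \col_i 'D_(basis_vec R i) f x.

(* Row i of the gradient of a map is the transposed gradient of component i;
   the library's Jacobian of row-vector maps is the transpose of this. *)
Definition jac (R : realType) (F : 'cV[R]_2 -> 'cV[R]_2) (x : 'cV[R]_2)
    : 'M[R]_2 :=
  \matrix_(i, j) 'D_(basis_vec R j) (fun y => F y i 0) x.

(* F is, on U, the time-t0-to-t flow map of the velocity field v, whose domain
   is the subset W of space-time; t < t0 is allowed. *)
Definition is_flow_map (R : realType) (W : set (R * 'cV[R]_2)%type)
    (v : R -> 'cV[R]_2 -> 'cV[R]_2) (t0 t : R) (U : set 'cV[R]_2)
    (F : 'cV[R]_2 -> 'cV[R]_2) : Prop :=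
  exists phi : R -> 'cV[R]_2 -> 'cV[R]_2, forall x0, U x0 ->
    [/\ phi t0 x0 = x0,
        forall s, Num.min t0 t <= s <= Num.max t0 t ->
          W (s, phi s x0) /\
          is_derive s 1 (fun s' => phi s' x0) (v s (phi s x0)) &
        F x0 = phi t x0].

Definition cauchy_green (R : realType) (F : 'cV[R]_2 -> 'cV[R]_2)
    (x : 'cV[R]_2) : 'M[R]_2 :=
  (jac F x)^T *m jac F x.

(* Pointwise spectral data of C. No regularity of the eigenvectors in x is
   assumed: they are arbitrary choices, made independently at each point. *)
Definition eigen_data (R : realType) (C : 'cV[R]_2 -> 'M[R]_2)
    (U : set 'cV[R]_2) (lambda1 lambda2 : 'cV[R]_2 -> R)
    (xi1 xi2 : 'cV[R]_2 -> 'cV[R]_2) : Prop :=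
  forall x, U x ->
    [/\ 0 < lambda1 x <= lambda2 x,
        C x *m xi1 x = lambda1 x *: xi1 x,
        C x *m xi2 x = lambda2 x *: xi2 x &
        [/\ inner (xi1 x) (xi1 x) = 1,
            inner (xi2 x) (xi2 x) = 1 &
            inner (xi1 x) (xi2 x) = 0]].

(* ((0, -1), (1, 0)) *)
Definition Omega (R : realType) : 'M[R]_2 := delta_mx 1 0 - delta_mx 0 1.

Definition shear_tensor (R : realType) (C : 'cV[R]_2 -> 'M[R]_2)
    (x : 'cV[R]_2) : 'M[R]_2 :=
  2^-1 *: (C x *m Omega R - Omega R *m C x).

(* Lorentzian where C has distinct eigenvalues, zero elsewhere. *)
Definition metric (R : realType) (C : 'cV[R]_2 -> 'M[R]_2)
    (x u v : 'cV[R]_2) : R :=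
  inner u (shear_tensor C x *m v).

Definition shear (R : realType) (C : 'cV[R]_2 -> 'M[R]_2)
    (x u : 'cV[R]_2) : R :=
  inner u (shear_tensor C x *m u) / Num.sqrt (inner u (C x *m u) * inner u u).

Definition metric_lagrangian (R : realType) (C : 'cV[R]_2 -> 'M[R]_2)
    (x u : 'cV[R]_2) : R :=
  metric C x u u.

Definition regular_curve (R : realType) (U : set 'cV[R]_2) (sigma : R)
    (r : R -> 'cV[R]_2) : Prop :=
  [/\ 0 < sigma,
      smooth_around `[0, sigma]%classic r &
      forall s, `[0, sigma]%classic s -> U (r s) /\ derive1 r s != 0].

(* The Euler-Lagrange equation on [a, b] of a Lagrangian L x u in position x
   and velocity u: the momentum, i.e. the gradient of L in u along the curve,
   is differentiable with derivative the gradient of L in x along the curve. *)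
Definition euler_lagrange (R : realType) (L : 'cV[R]_2 -> 'cV[R]_2 -> R)
    (a b : R) (r : R -> 'cV[R]_2) : Prop :=
  forall s, `[a, b]%classic s ->
    is_derive s 1 (fun s' => grad (L (r s')) (derive1 r s'))
      (grad (fun x => L x (derive1 r s)) (r s)).

(* Stationarity of the averaged shear is expressed by the Euler-Lagrange equation
   of its integrand; the constant factor 1 / sigma plays no role in it. *)
Definition perfect_shearless_barrier (R : realType)
    (C : 'cV[R]_2 -> 'M[R]_2) (U : set 'cV[R]_2) (sigma : R)
    (r : R -> 'cV[R]_2) : Prop :=
  [/\ regular_curve U sigma r,
      euler_lagrange (shear C) 0 sigma r &
      forall s, `[0, sigma]%classic s -> shear C (r s) (derive1 r s) = 0].

(* psi is a change of parameter s = psi tau from [a, b] onto [0, sigma]; it may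
   reverse orientation. *)
Definition reparametrization (R : realType) (a b sigma : R) (psi : R -> R)
    : Prop :=
  [/\ a < b,
      smooth_around `[a, b]%classic psi,
      forall tau, `[a, b]%classic tau -> derive1 psi tau != 0 &
      psi @` `[a, b]%classic = `[0, sigma]%classic].

Definition null_geodesic (R : realType)
    (C : 'cV[R]_2 -> 'M[R]_2) (U : set 'cV[R]_2) (sigma : R)
    (r : R -> 'cV[R]_2) : Prop :=
  regular_curve U sigma r /\
  exists (a b : R) (psi : R -> R),
    [/\ reparametrization a b sigma psi,
        euler_lagrange (metric_lagrangian C) a b (r \o psi) &
        forall tau, `[a, b]%classic tau ->
          metric_lagrangian C ((r \o psi) tau) (derive1 (r \o psi) tau) = 0].

Definition tangent_to (R : realType) (xi : 'cV[R]_2 -> 'cV[R]_2)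
    (I : set R) (r : R -> 'cV[R]_2) : Prop :=
  forall s, I s -> exists c : R, derive1 r s = c *: xi (r s).

Definition composed_of_tensorlines (R : realType)
    (lambda1 lambda2 : 'cV[R]_2 -> R) (xi1 xi2 : 'cV[R]_2 -> 'cV[R]_2)
    (sigma : R) (r : R -> 'cV[R]_2) : Prop :=
  forall I : set R, is_interval I -> I `<=` `[0, sigma]%classic ->
    (forall s, I s -> lambda1 (r s) != lambda2 (r s)) ->
    tangent_to xi1 I r \/ tangent_to xi2 I r.

(* Main.v *)
Require Import Defs.
From HB Require Import structures.
From mathcomp Require Import all_boot all_order all_algebra.
From mathcomp Require Import all_classical all_reals all_analysis.
From mathcomp Require Import ring lra.
Import Order.TTheory GRing.Theory Num.Theory.
Import numFieldNormedType.Exports.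
Local Open Scope classical_set_scope.
Local Open Scope ring_scope.

(** Write H(x, u) = <u, D u> and N(x, u) = <u, C u> <u, u>, so that the shear is
    p = H / sqrt N. Along a perfect shearless barrier H and d/ds H vanish, hence
    only the terms without a factor H survive in the Euler-Lagrange equation of
    p, which becomes d/ds (d_u H / sqrt N) = d_x H / sqrt N. This is the
    Euler-Lagrange equation of H after the change of parameter s = psi(tau) with
    psi' = 1 / sqrt N. Such a psi is the inverse of a primitive of sqrt N.

    In an orthonormal eigenbasis, H = +- (lambda2 - lambda1) a b for
    u = a xi1 + b xi2, so a null vector is an eigenvector where the eigenvalues
    differ. The continuous function 2 <u, C u> - tr C <u, u>, which equals
    (lambda1 - lambda2) (a^2 - b^2), then has no zero on an interval without
    singularities, and its sign tells which eigenvector is tangent. *)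

Set Implicit Arguments.
Unset Strict Implicit.

(** * Directional derivatives *)

Section DirectionalDerivatives.
Context {R : realType}.

(** Along the line the one-variable difference quotient is literally the directional one, so
    one-variable results serve for directional derivatives. *)
Lemma is_derive_line (V W : normedModType R) (f : V -> W) (p v : V) (t : R) :
  derivable f (p + t *: v) v ->
  is_derive t 1 (fun h : R => f (p + h *: v)) ('D_v f (p + t *: v)).
Proof.
have E : (fun h : R => h^-1 *: (((fun h : R => f (p + h *: v)) \o shift t) (h *: 1)
            - f (p + t *: v)))
    = (fun h : R => h^-1 *: ((f \o shift (p + t *: v)) (h *: v) - f (p + t *: v))).
  apply/funext => h /=; congr (_ *: (f _ - _)).
  by rewrite [h%:A]mulr1 scalerDl addrCA.
by move=> df; split; rewrite /derivable /derive E.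
Qed.

(** One directional derivative gives no differential of [f] whose linearity could be used.
    Restricted to the line through [x], however, the map is differentiable as a function of one real
    variable, and the factor [c] comes from the chain rule with [k h = h * c]. *)
Lemma is_deriveZdir (V W : normedModType R) (f : V -> W) (x v : V) (c : R) (l : W) :
  is_derive x v f l -> is_derive x (c *: v) f (c *: l).
Proof.
move=> [df <-].
pose g (h : R) := f (x + h *: v).
pose k (h : R) : R := h * c.
have d0 : derivable f (x + 0 *: v) v by rewrite scale0r addr0.
have [d1 d2] := is_derive_line d0.
have k0 : k 0 = 0 by rewrite /k mul0r.
have kd : is_derive (0 : R) 1 k c.
  have := is_deriveM (is_derive_id (0 : R) 1) (is_derive_cst c (0 : R) 1).
  by rewrite scaler0 add0r => h; apply: is_derive_eq h _; rewrite [LHS]mulr1.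
have [kd1 kd2] := kd.
have dk : differentiable k 0 by exact/derivable1_diffP.
have dg : differentiable g (k 0) by rewrite k0; exact/derivable1_diffP.
have dgk : differentiable (g \o k) (0 : R) by exact: differentiable_comp.
have E1 : 'd k 0 1 = c by have := @deriveE _ _ _ k 0 1 dk; rewrite kd2.
have E2 : 'd g (k 0) 1 = 'D_v f x.
  have := @deriveE _ _ _ g (k 0) 1 dg; rewrite k0 => <-.
  by rewrite d2 scale0r addr0.
have e2 : 'D_1 (g \o k) 0 = c *: 'D_v f x.
  rewrite deriveE // diff_comp //= E1 -[X in 'd g _ X]mulr1.
  by rewrite -E2 -[X in 'd g _ X]/(c *: 1) linearZ.
have F : (fun h : R => h^-1 *: ((f \o shift x) (h *: (c *: v)) - f x)) =
  (fun h : R => h^-1 *: (((g \o k) \o shift 0) (h *: 1) - (g \o k) 0)).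
  apply/funext => h /=; rewrite k0 /g scale0r !addr0 [h%:A]mulr1 /k.
  by rewrite scalerA (addrC x).
have e1 : derivable (g \o k) (0 : R) 1 by exact/derivable1_diffP.
by split; [rewrite /derivable F | rewrite -e2 /derive F].
Qed.

(** The same restriction to a line reduces this to the one-variable chain rule. *)
Lemma is_derive_comp_dir (V : normedModType R) (f : R -> R) (g : V -> R) (x v : V) (a b : R) :
  is_derive (g x) 1 f a -> is_derive x v g b -> is_derive x v (f \o g) (a * b).
Proof.
move=> hf [dg <-].
have dg0 : derivable g (x + 0 *: v) v by rewrite scale0r addr0.
have h1 : is_derive (0 : R) 1 (fun h : R => g (x + h *: v)) ('D_v g x).
  by have := is_derive_line dg0; rewrite scale0r addr0.
have hf' : is_derive ((fun h : R => g (x + h *: v)) 0) 1 f a by rewrite /= scale0r addr0.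
have [h2 h3] := is_derive1_comp hf' h1.
have F : (fun h : R => h^-1 *: (((f \o g) \o shift x) (h *: v) - (f \o g) x)) =
  (fun h : R => h^-1 *: (((f \o (fun h => g (x + h *: v))) \o shift 0) (h *: 1)
      - (f \o (fun h => g (x + h *: v))) (0 : R))).
  apply/funext => h /=; rewrite scale0r !addr0 [h%:A]mulr1.
  by rewrite (addrC x).
by split; [rewrite /derivable F | rewrite -h3 /derive F].
Qed.

Lemma is_derive_mxP (V : normedModType R) m n (M : V -> 'M[R]_(m, n)) (x v : V) (l : 'M[R]_(m, n)) :
  is_derive x v M l <-> forall i j, is_derive x v (fun y => M y i j) (l i j).
Proof.
split=> [[dM <-] i j|h].
  split; first by have /derivable_mxP := dM.
  by rewrite derive_mx // mxE.
have dM : derivable M x v by apply/derivable_mxP => i j; have [] := h i j.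
by split=> //; apply/matrixP => i j; rewrite derive_mx // mxE; have [] := h i j.
Qed.

Lemma is_derive_coord m n (M v : 'M[R]_(m, n)) i j :
  is_derive M v (fun y : 'M[R]_(m, n) => y i j) (v i j).
Proof. by have /is_derive_mxP h := is_derive_id M v; exact: h. Qed.

Lemma continuous_mxP (T : topologicalType) m n (M : T -> 'M[R]_(m, n)) (x : T) :
  {for x, continuous M} <-> forall i j, {for x, continuous (fun y => M y i j)}.
Proof.
split=> [cM i j|h].
  exact: (@continuous_comp _ _ _ M (fun N => N i j) x cM (@coord_continuous _ _ _ _ _ _)).
apply/cvg_ballP => e e0.
have : \forall y \near x, forall ij : 'I_m * 'I_n, ball (M x ij.1 ij.2) e (M y ij.1 ij.2).
  by apply: filter_forall => -[i j] /=; have /cvg_ballP := h i j; exact.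
by apply: filterS => y hy; split => // i j; exact: (hy (i, j)).
Qed.

Lemma derivable1_continuous (W : normedModType R) (f : R -> W) (x : R) :
  derivable f x 1 -> {for x, continuous f}.
Proof. by move=> /derivable1_diffP /differentiable_continuous. Qed.

End DirectionalDerivatives.

(** * Calculus of C^n functions *)

Section CkCalculus.
Context {R : realType}.

(** Openness of [A] turns equality on [A] into equality near each of its points, which is all that
    limits and derivatives see. *)
Lemma Ck_ext (V W : normedModType R) n (A : set V) (f g : V -> W) :
  open A -> (forall x, A x -> f x = g x) -> Ck n A f -> Ck n A g.
Proof.
move=> oA; elim: n f g => [|n IH] f g fg /=.
  move=> cf x Ax; have := cf x Ax; rewrite /prop_for /continuous_at fg //.
  apply: cvg_trans; apply: near_eq_cvg.
  by apply: filterS (open_nbhs_nbhs (conj oA Ax)) => y /fg ->.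
have nfg x : A x -> \near x, f x = g x.
  by move=> Ax; apply: filterS (open_nbhs_nbhs (conj oA Ax)) => y /fg ->.
move=> [df Cf]; split=> [x v Ax|v].
  by apply: near_eq_derivable (df x v Ax); exact: nfg.
by apply: IH (Cf v) => x Ax; apply: near_eq_derive; exact: nfg.
Qed.

Lemma Ck_subset (V W : normedModType R) n (A B : set V) (f : V -> W) :
  A `<=` B -> Ck n B f -> Ck n A f.
Proof.
move=> AB; elim: n f => [|n IH] f /=; first by move=> cf x /AB; exact: cf.
by move=> [df Cf]; split=> [x v /AB|v]; [exact: df|exact: IH].
Qed.

Lemma smooth_on_derive (V W : normedModType R) (A : set V) (f : V -> W) (v : V) :
  smooth_on A f -> smooth_on A (fun x => 'D_v f x).
Proof. by move=> sf n; have [_] := sf n.+1; apply. Qed.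

Lemma smooth_on_derivable (V W : normedModType R) (A : set V) (f : V -> W) (x v : V) :
  smooth_on A f -> A x -> derivable f x v.
Proof. by move=> /(_ 1%N)[df _]; exact: df. Qed.

Lemma smooth_on_continuous (V W : normedModType R) (A : set V) (f : V -> W) (x : V) :
  smooth_on A f -> A x -> {for x, continuous f}.
Proof. by move=> /(_ 0%N); exact. Qed.

Lemma Ck_coord (V : normedModType R) k (A : set V) m n (f : V -> 'M[R]_(m, n)) i j :
  open A -> Ck k A f -> Ck k A (fun x => f x i j).
Proof.
move=> oA; elim: k f => [|k IH] f /=.
  by move=> cf x /cf /continuous_mxP; exact.
move=> [df Cf]; split=> [x v Ax|v].
  by have /derivable_mxP := df x v Ax; exact.
apply: (Ck_ext oA _ (IH _ (Cf v))) => x Ax.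
by rewrite derive_mx ?mxE //; exact: df.
Qed.

Lemma Ck_cst (V W : normedModType R) n (A : set V) (c : W) : Ck n A (cst c).
Proof.
elim: n c => [|n IH] c /=; first by move=> x _; exact: cst_continuous.
split=> [x v _|v]; first exact: derivable_cst.
by have -> : (fun x => 'D_v (cst c) x) = cst (0 : W) by apply/funext => x; exact: derive_cst.
Qed.

Lemma CkD (V W : normedModType R) n (A : set V) (f g : V -> W) :
  open A -> Ck n A f -> Ck n A g -> Ck n A (fun x => f x + g x).
Proof.
move=> oA; elim: n f g => [|n IH] f g /=.
  by move=> cf cg x Ax; apply: cvgD; [exact: cf|exact: cg].
move=> [df Cf] [dg Cg]; split=> [x v Ax|v].
  by apply: derivableD; [exact: df|exact: dg].
apply: (Ck_ext oA _ (IH _ _ (Cf v) (Cg v))) => x Ax.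
by rewrite (deriveD (df x v Ax) (dg x v Ax)).
Qed.

Lemma CkZ (V : normedModType R) n (A : set V) (c : R) (f : V -> R) :
  open A -> Ck n A f -> Ck n A (fun x => c * f x).
Proof.
move=> oA; elim: n f => [|n IH] f /=.
  by move=> cf x Ax; apply: cvgM; [exact: cvg_cst|exact: cf].
move=> [df Cf]; split=> [x v Ax|v].
  by apply: derivableZ; exact: df.
apply: (Ck_ext oA _ (IH _ (Cf v))) => x Ax.
by rewrite (deriveZ c (df x v Ax)).
Qed.

Lemma CkB (V : normedModType R) n (A : set V) (f g : V -> R) :
  open A -> Ck n A f -> Ck n A g -> Ck n A (fun x => f x - g x).
Proof.
move=> oA Cf Cg; have := CkD oA Cf (CkZ (-1) oA Cg).
by apply: Ck_ext oA _ => x _; rewrite mulN1r.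
Qed.

Lemma CkS_is_derive (f : R -> R) n (A : set R) x :
  Ck n.+1 A f -> A x -> is_derive x 1 f ('D_1 f x).
Proof. by move=> [df _] Ax; apply/derivableP; exact: df. Qed.

(** On the real line derivability in direction 1 already gives continuity; in a general space
    directional derivatives do not, hence the restriction to [R]. *)
Lemma CkS n (A : set R) (f : R -> R) : Ck n.+1 A f -> Ck n A f.
Proof.
elim: n f => [|n IH] f.
  by move=> [df _] x Ax; apply: derivable1_continuous; exact: df.
by move=> [df Cf]; split => // v; exact: IH (Cf v).
Qed.

(** Every direction [v] on the line is [v] times 1, so the derivative in that direction is [v * g].
    The regularity proofs below use this to reduce C^(n+1) to exhibiting a derivative of class
    C^n. *)
Lemma is_derive_CkS n (A : set R) (f g : R -> R) : open A ->
  (forall x, A x -> is_derive x 1 f (g x)) -> Ck n A g -> Ck n.+1 A f.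
Proof.
move=> oA fg Cg.
have dfv x v : A x -> is_derive x v f (v * g x).
  move=> Ax; have := @is_deriveZdir _ _ _ f x 1 v (g x) (fg x Ax).
  by rewrite [_ *: 1]mulr1.
split=> [x v Ax|v]; first by have [] := dfv x v Ax.
apply: (Ck_ext oA _ (CkZ v oA Cg)) => x Ax.
by have [_ ->] := dfv x v Ax.
Qed.

Lemma CkM n (A : set R) (f g : R -> R) :
  open A -> Ck n A f -> Ck n A g -> Ck n A (fun x => f x * g x).
Proof.
move=> oA; elim: n f g => [|n IH] f g.
  by move=> cf cg x Ax /=; apply: cvgM; [exact: cf|exact: cg].
move=> Cf Cg; apply: (is_derive_CkS oA).
  by move=> x Ax; exact: is_deriveM (CkS_is_derive Cf Ax) (CkS_is_derive Cg Ax).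
apply: CkD => //.
  by apply: IH; [exact: CkS|have [_] := Cg; exact].
by apply: IH; [exact: CkS|have [_] := Cf; exact].
Qed.

Lemma Ck_comp n (A B : set R) (f g : R -> R) : open A -> open B ->
  (forall x, B x -> A (g x)) -> Ck n A f -> Ck n B g -> Ck n B (fun x => f (g x)).
Proof.
move=> oA oB gBA; elim: n f => [|n IH] f.
  move=> cf cg x Bx; apply: (@continuous_comp _ _ _ g f); first exact: cg.
  by apply: cf; exact: gBA.
move=> Cf Cg; apply: (is_derive_CkS oB).
  move=> x Bx; apply: is_derive1_comp; last exact: (CkS_is_derive Cg Bx).
  by apply: CkS_is_derive Cf _; exact: gBA.
apply: CkM => //; last by have [_] := Cg; exact.
by apply: (IH (fun y => 'D_1 f y)); [have [_] := Cf; exact | exact: CkS].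
Qed.

(** The derivative [- f' / f^2] contains [f^-1] again, which is C^n by induction. *)
Lemma Ck_inv n (A : set R) (f : R -> R) : open A ->
  (forall x, A x -> f x != 0) -> Ck n A f -> Ck n A (fun x => (f x)^-1).
Proof.
move=> oA f0; elim: n => [|n IH] Cf.
  by move=> x Ax; apply: cvgV; [exact: f0|exact: Cf].
have IH' := IH (CkS Cf).
apply: (@is_derive_CkS n A (fun x => (f x)^-1)
  (fun x => (-1) * ('D_1 f x * ((f x)^-1 * (f x)^-1))) oA).
  move=> x Ax; have h := CkS_is_derive Cf Ax.
  have [d1 _] := h.
  split; first exact: (derivableV (f0 x Ax) d1).
  rewrite (deriveV (f0 x Ax) d1) [LHS]mulNr mulN1r mulrC expr2 invfM.
  by [].
apply: CkZ => //; apply: CkM => //; last exact: CkM.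
by have [_] := Cf; exact.
Qed.

(** Likewise by induction, the derivative [f' / (2 sqrt f)] being built from [sqrt f] itself. *)
Lemma Ck_sqrt n (A : set R) (f : R -> R) : open A ->
  (forall x, A x -> 0 < f x) -> Ck n A f -> Ck n A (fun x => Num.sqrt (f x)).
Proof.
move=> oA f0; elim: n => [|n IH] Cf.
  move=> x Ax; apply: (@continuous_comp _ _ _ f Num.sqrt); first exact: Cf.
  exact: sqrt_continuous.
have IH' := IH (CkS Cf).
apply: (@is_derive_CkS n A (fun x => Num.sqrt (f x))
  (fun x => (2 * Num.sqrt (f x))^-1 * 'D_1 f x) oA).
  move=> x Ax; apply: is_derive1_comp; last exact: CkS_is_derive Cf Ax.
  by apply: is_derive1_sqrt; exact: f0.
apply: CkM => //; last by have [_] := Cf; exact.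
apply: Ck_inv => //; last exact: CkZ.
by move=> x Ax; rewrite mulf_neq0 ?pnatr_eq0 // gt_eqF // sqrtr_gt0; exact: f0.
Qed.

End CkCalculus.

(** * The chain rule in the plane *)

Section PlaneChainRule.
Context {R : realType}.

Lemma line_mvt (V : normedModType R) (f : V -> R) (p v : V) :
  (forall t : R, 0 <= t <= 1 -> derivable f (p + t *: v) v) ->
  exists2 t : R, 0 <= t <= 1 & f (p + v) - f p = 'D_v f (p + t *: v).
Proof.
move=> df.
pose g (t : R) := f (p + t *: v).
have dg (t : R) : 0 <= t <= 1 -> is_derive t 1 g ('D_v f (p + t *: v)).
  by move=> t01; apply: is_derive_line; exact: df.
have [||t t01] := @MVT_segment R g (fun t => 'D_v f (p + t *: v)) 0 1 ler01.
- move=> t; rewrite in_itv /= => /andP[t0 t1]; apply: dg.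
  by rewrite !ltW.
- apply: derivable_within_continuous => t; rewrite in_itv /= => t01.
  by have [] := dg t t01.
rewrite /g scale1r scale0r addr0 subr0 mulr1 => E; exists t => //.
Qed.

Lemma partial_mvt (f : 'cV[R]_2 -> R) (p : 'cV[R]_2) (c : R) (j : 'I_2) :
  (forall t : R, 0 <= t <= 1 -> derivable f (p + (t * c) *: basis_vec R j) (basis_vec R j)) ->
  exists2 t : R, 0 <= t <= 1 &
    f (p + c *: basis_vec R j) - f p
      = 'D_(basis_vec R j) f (p + (t * c) *: basis_vec R j) * c.
Proof.
move=> df.
have D (t : R) : 0 <= t <= 1 -> is_derive (p + t *: (c *: basis_vec R j)) (c *: basis_vec R j) f
    ('D_(basis_vec R j) f (p + (t * c) *: basis_vec R j) * c).
  move=> t01; rewrite mulrC scalerA; apply: is_deriveZdir.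
  by apply/derivableP; exact: df.
have [|t t01 ->] := @line_mvt _ f p (c *: basis_vec R j).
  by move=> t /D[].
by exists t => //; have [_ ->] := D t t01.
Qed.

Lemma ord2P (P : 'I_2 -> Prop) : P 0 -> P 1 -> forall i, P i.
Proof.
move=> P0 P1 [[|[|//]] h].
  by have <- : 0 = Ordinal h by apply/val_inj.
by have <- : 1 = Ordinal h by apply/val_inj.
Qed.

(** Go from [x] to [y] along two sides of a coordinate rectangle, the second coordinate first, and
    apply the mean value theorem on each side. The coordinatewise bounds keep [z] and [w] in the
    ball and make them tend to [x] as [y] does. *)
Lemma plane_mvt (f : 'cV[R]_2 -> R) (x : 'cV[R]_2) (e : R) :
  (forall y, ball x e y -> forall j, derivable f y (basis_vec R j)) ->
  forall y, ball x e y ->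
  exists z w : 'cV[R]_2, [/\ forall k, `|x k 0 - z k 0| <= `|x k 0 - y k 0|,
    forall k, `|x k 0 - w k 0| <= `|x k 0 - y k 0| &
    f y - f x = 'D_(basis_vec R 0) f z * (y 0 0 - x 0 0)
              + 'D_(basis_vec R 1) f w * (y 1 0 - x 1 0)].
Proof.
move=> df y xy.
have [e0 bxy] := xy.
(* Balls of matrices are those of the entrywise maximum norm, so a coordinatewise bound suffices. *)
have inb (z : 'cV[R]_2) : (forall k, `|x k 0 - z k 0| <= `|x k 0 - y k 0|) -> ball x e z.
  move=> h; split => // i j; rewrite (ord1 j); apply: le_lt_trans (h i) _.
  exact: bxy.
have shrink (t a b : R) : 0 <= t <= 1 -> `|a - (a + t * (b - a))| <= `|a - b|.
  move=> /andP[t0 t1]; rewrite opprD addNKr normrN normrM (ger0_norm t0).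
  by rewrite (distrC a b) ler_piMl.
set c0 := y 0 0 - x 0 0; set c1 := y 1 0 - x 1 0.
(* The corner of the path: [w] runs from [x] to [m], and [z] from [m] to [y]. *)
pose m := x + c1 *: basis_vec R 1.
pose w (t : R) := x + (t * c1) *: basis_vec R 1.
pose z (t : R) := m + (t * c0) *: basis_vec R 0.
have wP (t : R) : 0 <= t <= 1 -> forall k, `|x k 0 - w t k 0| <= `|x k 0 - y k 0|.
  move=> t01; apply: ord2P; rewrite /w !mxE /=.
    by rewrite mulr0 addr0 subrr normr0.
  by rewrite mulr1; exact: shrink.
have zP (t : R) : 0 <= t <= 1 -> forall k, `|x k 0 - z t k 0| <= `|x k 0 - y k 0|.
  move=> t01; apply: ord2P; rewrite /z !mxE /=.
    by rewrite mulr0 addr0 mulr1; exact: shrink.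
  by rewrite mulr0 addr0 mulr1 /c1 subrKC.
have [t t01 E1] := @partial_mvt f x c1 1 (fun t t01 => df _ (inb _ (wP t t01)) 1).
have [u u01 E0] := @partial_mvt f m c0 0 (fun t t01 => df _ (inb _ (zP t t01)) 0).
have my : m + c0 *: basis_vec R 0 = y.
  apply/colP; apply: ord2P; rewrite /m !mxE /=.
    by rewrite mulr0 addr0 mulr1 subrKC.
  by rewrite mulr0 addr0 mulr1 subrKC.
exists (z u), (w t); split; [exact: zP|exact: wP|].
by rewrite -E0 -E1 my -/m subrKA.
Qed.

(** By [plane_mvt] the increment of [f] along the curve combines partial derivatives at intermediate
    points. These points tend to [r s], where the partial derivatives are continuous. *)
Lemma is_derive_plane_comp (f : 'cV[R]_2 -> R) (r : R -> 'cV[R]_2) (s : R) (l : 'cV[R]_2) :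
  (\forall y \near r s, forall j, derivable f y (basis_vec R j)) ->
  (forall j, {for r s, continuous (fun y => 'D_(basis_vec R j) f y)}) ->
  is_derive s 1 r l ->
  is_derive s 1 (fun t => f (r t))
    ('D_(basis_vec R 0) f (r s) * l 0 0 + 'D_(basis_vec R 1) f (r s) * l 1 0).
Proof.
move=> /nbhs_ballP[e /= e0 df] cf dr.
have cr : {for s, continuous r}.
  by apply: derivable1_continuous; have [] := dr.
have hs : (h + s) @[h --> (0 : R)^'] --> s.
  rewrite -[X in _ --> X]add0r; apply: cvgD; last exact: cvg_cst.
  exact: cvg_within.
have rs : r (h + s) @[h --> (0 : R)^'] --> r s by exact: (cvg_comp _ _ hs cr).
(* The implication lets intermediate points be chosen for every [h]: where [r (h + s)] is outside
   the ball, the pair [(0, 0)] is taken. *)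
pose P (h : R) (zw : 'cV[R]_2 * 'cV[R]_2) := ball (r s) e (r (h + s)) ->
  [/\ forall k, `|r s k 0 - zw.1 k 0| <= `|r s k 0 - r (h + s) k 0|,
    forall k, `|r s k 0 - zw.2 k 0| <= `|r s k 0 - r (h + s) k 0| &
    f (r (h + s)) - f (r s) = 'D_(basis_vec R 0) f zw.1 * (r (h + s) 0 0 - r s 0 0)
              + 'D_(basis_vec R 1) f zw.2 * (r (h + s) 1 0 - r s 1 0)].
have [zw zwP] : {zw : R -> 'cV[R]_2 * 'cV[R]_2 & forall h, P h (zw h)}.
  apply: choice => h; have [hb|nb] := pselect (ball (r s) e (r (h + s))).
    have [z [w [? ? ?]]] := plane_mvt df hb.
    by exists (z, w).
  by exists (0, 0) => /nb.
have near_in e' : 0 < e' -> \forall h \near (0 : R)^', ball (r s) e' (r (h + s)).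
  by move=> e'0; have /cvg_ballP := rs; exact.
have cz (p : 'cV[R]_2 * 'cV[R]_2 -> 'cV[R]_2) :
    (forall h, ball (r s) e (r (h + s)) ->
      forall k, `|r s k 0 - p (zw h) k 0| <= `|r s k 0 - r (h + s) k 0|) ->
    p (zw h) @[h --> (0 : R)^'] --> r s.
  move=> hp; apply/cvg_ballP => e' e'0.
  near=> h; split => // i j; rewrite (ord1 j).
  apply: le_lt_trans (hp h _ i) _; first by near: h; exact: near_in.
  suff [_] : ball (r s) e' (r (h + s)) by exact.
  by near: h; exact: near_in.
have q k : (h^-1 * (r (h + s) k 0 - r s k 0)) @[h --> (0 : R)^'] --> l k 0.
  have /is_derive_mxP/(_ k 0)[d1 d2] := dr.
  rewrite -d2; apply: cvg_trans d1; apply: near_eq_cvg; near=> h.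
  by rewrite /= [h%:A]mulr1.
have C : (h^-1 *: (((fun t => f (r t)) \o shift s) (h *: 1) - f (r s))) @[h --> (0 : R)^']
   --> 'D_(basis_vec R 0) f (r s) * l 0 0 + 'D_(basis_vec R 1) f (r s) * l 1 0.
  have c1 : 'D_(basis_vec R 0) f (zw h).1 @[h --> (0 : R)^'] --> 'D_(basis_vec R 0) f (r s).
    apply: (cvg_comp _ _ (cz fst _) (cf 0)).
    by move=> h /zwP[].
  have c2 : 'D_(basis_vec R 1) f (zw h).2 @[h --> (0 : R)^'] --> 'D_(basis_vec R 1) f (r s).
    apply: (cvg_comp _ _ (cz snd _) (cf 1)).
    by move=> h /zwP[].
  apply: cvg_trans (cvgD (cvgM c1 (q 0)) (cvgM c2 (q 1))).
  apply: near_eq_cvg; near=> h.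
  rewrite /= [h%:A]mulr1.
  have [|_ _ ->] := zwP h; first by near: h; exact: near_in.
  by rewrite [RHS]mulrDr !(mulrCA h^-1).
split; first by apply/cvg_ex; eexists; exact: C.
exact/cvg_lim.
Unshelve. all: by end_near. Qed.

(** The derivative is a sum of products of partial derivatives along [r] with coordinates of [r'].
    The former are again compositions of this kind, so the induction runs over all smooth [f]. *)
Lemma Ck_plane_comp n (A : set 'cV[R]_2) (B : set R) (f : 'cV[R]_2 -> R) (r : R -> 'cV[R]_2) :
  open A -> open B -> (forall s, B s -> A (r s)) -> smooth_on A f -> smooth_on B r ->
  Ck n B (fun s => f (r s)).
Proof.
move=> oA oB rBA + sr; elim: n f => [|n IH] f sf.
  move=> s Bs; apply: (@continuous_comp _ _ _ r f); first exact: (smooth_on_continuous sr Bs).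
  by apply: (smooth_on_continuous sf); exact: rBA.
apply: (is_derive_CkS oB).
  move=> s Bs; apply: is_derive_plane_comp.
  - apply: filterS (open_nbhs_nbhs (conj oA (rBA _ Bs))) => y Ay j.
    exact: smooth_on_derivable sf Ay.
  - by move=> j; apply: smooth_on_continuous (smooth_on_derive _ sf) (rBA _ Bs).
  - by apply/derivableP; exact: smooth_on_derivable sr Bs.
have h j : Ck n B (fun s => 'D_(basis_vec R j) f (r s) * 'D_1 r s j 0).
  apply: CkM => //; first exact: (IH (fun y => 'D_(basis_vec R j) f y) (smooth_on_derive _ sf)).
  have s1 : smooth_on B (fun s : R => 'D_1 r s) by exact: (@smooth_on_derive R R _ B r 1 sr).
  exact: (Ck_coord j 0 oB (s1 n)).
exact: CkD (h 0) (h 1).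
Qed.

End PlaneChainRule.

(** * Change of parameter *)

Section TimeChange.
Context {R : realType}.

Lemma antiderivative (G : R -> R) (a b : R) :
  (forall x, a <= x <= b -> {for x, continuous G}) ->
  exists T : R -> R, forall x, a < x < b -> is_derive x 1 T (G x).
Proof.
move=> cG.
have iG : (@lebesgue_measure R).-integrable `[a, b]%classic (EFin \o G).
  apply: continuous_compact_integrable; first exact: segment_compact.
  apply: continuous_in_subspaceT => x; rewrite inE /= in_itv /= => xab.
  exact: cG.
exists (fun x => (\int[@lebesgue_measure R]_(t in `[a, x]) G t)%R) => x /andP[ax xb].
have cx : {for x, continuous G} by apply: cG; rewrite !ltW.
have [d1 d2] := continuous_FTC1_closed xb iG ax cx.
by split; [exact: d1|rewrite -derive1E; exact: d2].
Qed.

(** [psi] is the inverse of a primitive [T] of [G], strictly increasing since [G] is positive, with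
    [a = T 0] and [b = T sigma]. The open set [J] gives room for two-sided derivatives at [a] and
    [b]. *)
Lemma time_change (G : R -> R) (sigma e : R) : 0 < sigma -> 0 < e ->
  (forall x, - e < x < sigma + e -> 0 < G x) ->
  smooth_on `]- e, sigma + e[%classic G ->
  exists (a b : R) (psi : R -> R) (J : set R),
    [/\ reparametrization a b sigma psi, open J, `[a, b]%classic `<=` J &
      forall tau, J tau -> - e < psi tau < sigma + e /\
        is_derive tau 1 psi (G (psi tau))^-1].
Proof.
move=> s0 e0 Gpos sG.
(* The margin [e] is halved for the segment on which [G] is integrated and quartered for [[c, d]],
   so that [T] has derivative [G] at [c] and [d] too. *)
have [|T dT0] := @antiderivative G (- (e / 2)) (sigma + e / 2).
  move=> x xh; apply: (smooth_on_continuous sG).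
  by rewrite /= in_itv /=; lra.
pose c := - (e / 4); pose d := sigma + e / 4.
have cd : c < d by rewrite /c /d; lra.
have dT x : c <= x <= d -> is_derive x 1 T (G x).
  by move=> h; apply: dT0; move: h; rewrite /c /d; lra.
have GP x : c <= x <= d -> 0 < G x.
  by move=> h; apply: Gpos; move: h; rewrite /c /d; lra.
have cT x : c <= x <= d -> {for x, continuous T}.
  by move=> /dT [h _]; exact: derivable1_continuous.
have Tlt x y : c <= x -> x < y -> y <= d -> T x < T y.
  move=> cx xy yd.
  have [||z zxy] := @MVT R T G x y xy.
  - move=> z; rewrite in_itv /= => zxy; apply: dT; lra.
  - apply: continuous_in_subspaceT => z; rewrite inE /= in_itv /= => zxy.
    by apply: cT; lra.
  move: zxy; rewrite in_itv /= => zxy E.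
  rewrite -subr_gt0 E mulr_gt0 ?subr_gt0 //; apply: GP; lra.
have Tle x y : c <= x <= d -> c <= y <= d -> (T x <= T y) = (x <= y).
  move=> hx hy; case: (ltgtP x y) => [xy|yx|->]; last by rewrite lexx.
    by apply: ltW; apply: Tlt => //; lra.
  by apply/negbTE; rewrite -ltNge; apply: Tlt => //; lra.
have Tltm x y : c <= x <= d -> c <= y <= d -> (T x < T y) = (x < y).
  by move=> hx hy; rewrite !ltNge Tle.
have TI x y : c <= x <= d -> c <= y <= d -> T x = T y -> x = y.
  by move=> hx hy E; apply/eqP; rewrite eq_le -(Tle x y) // -(Tle y x) // E lexx.
(* The inverse of [T] on [[c, d]], with default value 0 off the range. *)
pose psi y := xget 0 [set x | c <= x <= d /\ T x = y].
have psiT x : c <= x <= d -> psi (T x) = x.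
  move=> hx; apply: xget_unique => // y [hy]; exact: TI.
have surj y : T c < y < T d -> exists2 x, c < x < d & T x = y.
  move=> hy.
  have [|||x] := @IVT R T c d y.
  - exact: ltW.
  - apply: continuous_in_subspaceT => z; rewrite inE /= in_itv /=; exact: cT.
  - by rewrite min_l ?max_r; lra.
  rewrite in_itv /= => hx E; exists x => //.
  have hc : c <= c <= d by rewrite lexx ltW.
  have hd : c <= d <= d by rewrite lexx ltW.
  by rewrite -(Tltm c x hc hx) -(Tltm x d hx hd) E.
have dpsi x : c < x < d -> is_derive (T x) 1 psi (G x)^-1.
  move=> hx.
  have nx : \forall y \near x, c <= y <= d.
    have : open_nbhs x `]c, d[%classic by split; [exact: interval_open|rewrite /= in_itv].
    by move=> /open_nbhs_nbhs; apply: filterS => y; rewrite /= in_itv /=; lra.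
  apply: is_derive_inverse.
  - by apply: filterS nx => y /psiT.
  - by apply: filterS nx => y /cT.
  - by apply: dT; lra.
  - by rewrite gt_eqF // GP //; lra.
have oJ : open `]T c, T d[%classic by exact: interval_open.
have dpsiJ y : `]T c, T d[%classic y -> (c < psi y < d) /\ is_derive y 1 psi (G (psi y))^-1.
  rewrite /= in_itv /= => /surj[x hx <-].
  by rewrite psiT; [split=> //; exact: dpsi|lra].
(* Bootstrap: [psi' = 1 / G(psi)] is as regular as [psi], so each induction step gains one
   derivative. *)
have spsi : smooth_on `]T c, T d[%classic psi.
  elim=> [|n IH].
    by move=> y /dpsiJ[_ [h _]]; exact: derivable1_continuous.
  apply: (is_derive_CkS (g := fun y => (G (psi y))^-1) oJ) => [y /dpsiJ[_]|]; first exact.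
  apply: (@Ck_inv _ n _ (fun x => G (psi x))) => //.
    by move=> y /dpsiJ[h _]; rewrite gt_eqF // GP //; lra.
  apply: (@Ck_comp _ n `]- e, sigma + e[%classic _ G psi) => //.
  by move=> y /dpsiJ[+ _]; rewrite /c /d /= in_itv /=; lra.
have h0 : c < 0 < d by rewrite /c /d; lra.
have hs : c < sigma < d by rewrite /c /d; lra.
have subJ y : `[T 0, T sigma]%classic y -> `]T c, T d[%classic y.
  rewrite /= !in_itv /= => hy.
  have : T c < T 0 by rewrite Tltm; lra.
  have : T sigma < T d by rewrite Tltm; lra.
  lra.
exists (T 0), (T sigma), psi, `]T c, T d[%classic; split => //; last first.
  by move=> y /dpsiJ[h1 h2]; split => //; move: h1; rewrite /c /d; lra.
split.
- by rewrite Tltm; lra.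
- by exists `]T c, T d[%classic.
- move=> y /subJ /dpsiJ[h [_ E]]; rewrite derive1E E invr_neq0 // gt_eqF // GP //; lra.
- apply/seteqP; split => [x [y hy <-]|x] /=.
    have /[dup] /dpsiJ[h _] := subJ y hy.
    rewrite /= in_itv /= => /surj[z hz zE]; move: h hy; rewrite -zE psiT; last by lra.
    by move=> _; rewrite /= !in_itv /= !Tle //; lra.
  rewrite in_itv /= => hx; exists (T x); last by rewrite psiT //; lra.
  by rewrite /= in_itv /= !Tle //; lra.
Qed.

End TimeChange.

(** * Quadratic forms of the plane *)

Section Forms.
Context {R : realType}.
Implicit Types (M : 'M[R]_2) (u v : 'cV[R]_2).

(** For symmetric [M] this is the quadratic form of [1/2 (M Omega - Omega M)] in coordinates. *)
Definition shear_form M u : R :=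
  M 0 1 * (u 0 0 * u 0 0 - u 1 0 * u 1 0) + (M 1 1 - M 0 0) * (u 0 0 * u 1 0).

(** The derivative of [shear_form M] at [u] in direction [v], that is, twice the associated bilinear
    form. *)
Definition shear_polar M u v : R :=
  M 0 1 * (2 * (u 0 0 * v 0 0 - u 1 0 * v 1 0)) +
  (M 1 1 - M 0 0) * (u 0 0 * v 1 0 + u 1 0 * v 0 0).

(** [<u, M u>] for symmetric [M]. *)
Definition strain_form M u : R :=
  M 0 0 * (u 0 0 * u 0 0) + 2 * (M 0 1 * (u 0 0 * u 1 0)) + M 1 1 * (u 1 0 * u 1 0).

Definition strain_polar M u v : R :=
  M 0 0 * (2 * (u 0 0 * v 0 0)) + 2 * (M 0 1 * (u 0 0 * v 1 0 + u 1 0 * v 0 0)) +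
  M 1 1 * (2 * (u 1 0 * v 1 0)).

Lemma innerE u v : inner u v = u 0 0 * v 0 0 + u 1 0 * v 1 0.
Proof.
by rewrite /inner mxE !big_ord_recl big_ord0 addr0 !mxE; congr (_ + u _ _ * v _ _);
  apply/val_inj.
Qed.

Lemma mulmx2E m n (A : 'M[R]_(m, 2)) (B : 'M[R]_(2, n)) i j :
  (A *m B) i j = A i 0 * B 0 j + A i 1 * B 1 j.
Proof.
by rewrite mxE !big_ord_recl big_ord0 addr0; congr (_ + A _ _ * B _ _); apply/val_inj.
Qed.

Lemma inner_gt0 u : u != 0 -> 0 < inner u u.
Proof.
rewrite innerE -!expr2 lt0r addr_ge0 ?sqr_ge0 // andbT.
apply: contra; rewrite paddr_eq0 ?sqr_ge0 // !sqrf_eq0 => /andP[/eqP u0 /eqP u1].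
by apply/eqP/colP; apply: ord2P; rewrite !mxE.
Qed.

Lemma inner_mulmxE M u : M 1 0 = M 0 1 -> inner u (M *m u) = strain_form M u.
Proof. by move=> sM; rewrite innerE !mulmx2E sM /strain_form; ring. Qed.

Section Tensor.
Variable C : 'cV[R]_2 -> 'M[R]_2.
Hypothesis symC : forall x, C x 1 0 = C x 0 1.

Lemma metric_lagrangianE x u : metric_lagrangian C x u = shear_form (C x) u.
Proof.
have DE i j : shear_tensor C x i j = 2^-1 *
    (C x i 0 * Omega R 0 j + C x i 1 * Omega R 1 j
     - (Omega R i 0 * C x 0 j + Omega R i 1 * C x 1 j)).
  by rewrite /shear_tensor [LHS]mxE [X in _ * X]mxE [X in _ + X]mxE !mulmx2E.
rewrite /metric_lagrangian /metric innerE !mulmx2E !DE /shear_form /Omega !mxE /= symC.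
by field.
Qed.

Lemma shearE x u :
  shear C x u = shear_form (C x) u / Num.sqrt (strain_form (C x) u * inner u u).
Proof.
by rewrite /shear -inner_mulmxE // -[X in X / _]/(metric_lagrangian C x u) metric_lagrangianE.
Qed.

End Tensor.

Lemma is_derive_shear_form M u v : is_derive u v (shear_form M) (shear_polar M u v).
Proof.
have h0 := @is_derive_coord R 2 1 u v 0 0; have h1 := @is_derive_coord R 2 1 u v 1 0.
rewrite /shear_form; apply: is_derive_eq.
by rewrite /shear_polar /GRing.scale /=; ring.
Qed.

Lemma is_derive_strain_form M u v : is_derive u v (strain_form M) (strain_polar M u v).
Proof.
have h0 := @is_derive_coord R 2 1 u v 0 0; have h1 := @is_derive_coord R 2 1 u v 1 0.
rewrite /strain_form; apply: is_derive_eq.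
by rewrite /strain_polar /GRing.scale /=; ring.
Qed.

Lemma is_derive_inner u v : is_derive u v (fun w => inner w w) (2 * inner u v).
Proof.
have h0 := @is_derive_coord R 2 1 u v 0 0; have h1 := @is_derive_coord R 2 1 u v 1 0.
rewrite (_ : (fun w => inner w w) = fun w : 'cV[R]_2 => w 0 0 * w 0 0 + w 1 0 * w 1 0); last first.
  by apply/funext => w; rewrite innerE.
apply: is_derive_eq.
by rewrite innerE /GRing.scale /=; ring.
Qed.

Lemma is_derive_inv_sqrt (y : R) : 0 < y ->
  is_derive y 1 (fun z => (Num.sqrt z)^-1)
    (- ((Num.sqrt y)^-1 * (Num.sqrt y)^-1 * (2 * Num.sqrt y)^-1)).
Proof.
move=> y0; have [d1 d2] := is_derive1_sqrt y0.
have s0 : Num.sqrt y != 0 by rewrite gt_eqF // sqrtr_gt0.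
split; first exact: (derivableV s0 d1).
by rewrite (deriveV s0 d1) d2 [LHS]mulNr expr2 invfM.
Qed.

Lemma shear_formZ M (c : R) u : shear_form M (c *: u) = c ^+ 2 * shear_form M u.
Proof. by rewrite /shear_form !mxE; ring. Qed.

Lemma shear_polarZ M (c : R) u v : shear_polar M (c *: u) v = shear_polar M u v * c.
Proof. by rewrite /shear_polar !mxE; ring. Qed.

End Forms.

(** * Null vectors in an orthonormal eigenbasis *)

Section Spectral.
Context {R : realType}.
Variables (M : 'M[R]_2) (l1 l2 : R) (xi1 xi2 : 'cV[R]_2).
Hypotheses (symM : M 1 0 = M 0 1) (l12 : 0 < l1 <= l2).
Hypotheses (E1 : M *m xi1 = l1 *: xi1) (E2 : M *m xi2 = l2 *: xi2).
Hypotheses (N1 : inner xi1 xi1 = 1) (N2 : inner xi2 xi2 = 1) (N12 : inner xi1 xi2 = 0).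

Let p := xi1 0 0.
Let q := xi1 1 0.
(** [delta] is the determinant of [(xi1, xi2)], hence 1 or -1. [alpha] and [beta] are the
    coordinates of [u] along [xi1] and along [xi1] turned clockwise by a right angle, which is
    [- delta xi2]. *)
Let delta := p * xi2 1 0 - q * xi2 0 0.
Let alpha (u : 'cV[R]_2) := p * u 0 0 + q * u 1 0.
Let beta (u : 'cV[R]_2) := q * u 0 0 - p * u 1 0.

Let pq1 : p * p + q * q = 1.
Proof. by rewrite -N1 innerE. Qed.

Let delta2 : delta * delta = 1.
Proof.
have e2 : xi2 0 0 * xi2 0 0 + xi2 1 0 * xi2 1 0 = 1 by rewrite -N2 innerE.
have e12 : p * xi2 0 0 + q * xi2 1 0 = 0 by rewrite -N12 innerE.
(* Lagrange's identity: the squared determinant is [|xi1|^2 |xi2|^2 - <xi1, xi2>^2]. *)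
transitivity ((p * p + q * q) * (xi2 0 0 * xi2 0 0 + xi2 1 0 * xi2 1 0)
   - (p * xi2 0 0 + q * xi2 1 0) ^+ 2); first by rewrite /delta; ring.
by rewrite pq1 e2 e12; ring.
Qed.

Let xi2E : xi2 0 0 = - (delta * q) /\ xi2 1 0 = delta * p.
Proof.
have e12 : p * xi2 0 0 + q * xi2 1 0 = 0 by rewrite -N12 innerE.
split.
  transitivity ((p * p + q * q) * xi2 0 0 - p * (p * xi2 0 0 + q * xi2 1 0)).
    by rewrite pq1 e12; ring.
  by rewrite /delta; ring.
transitivity ((p * p + q * q) * xi2 1 0 - q * (p * xi2 0 0 + q * xi2 1 0)).
  by rewrite pq1 e12; ring.
by rewrite /delta; ring.
Qed.

(** The spectral decomposition [M = l1 xi1 xi1^T + l2 xi2 xi2^T]; the sign [delta] enters squared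
    and disappears. *)
Let entries : [/\ M 0 0 = l1 * (p * p) + l2 * (q * q),
  M 0 1 = (l1 - l2) * (p * q) & M 1 1 = l1 * (q * q) + l2 * (p * p)].
Proof.
have [x0 x1] := xi2E.
have a1 : M 0 0 * p + M 0 1 * q = l1 * p by rewrite -mulmx2E E1 mxE.
have a2 : M 0 1 * p + M 1 1 * q = l1 * q by rewrite -symM -mulmx2E E1 mxE.
(* The eigenvector equation of [xi2] carries a factor [delta], removed by multiplying with [delta]
   once more. *)
have b1 : M 0 1 * p - M 0 0 * q = - (l2 * q).
  have : M 0 0 * xi2 0 0 + M 0 1 * xi2 1 0 = l2 * xi2 0 0 by rewrite -mulmx2E E2 mxE.
  rewrite x0 x1 => /(congr1 ( *%R delta)) h.
  transitivity (delta * delta * (M 0 1 * p - M 0 0 * q)); first by rewrite delta2 mul1r.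
  transitivity (delta * delta * - (l2 * q)); last by rewrite delta2 mul1r.
  transitivity (delta * (M 0 0 * - (delta * q) + M 0 1 * (delta * p))); first by ring.
  by rewrite h; ring.
have b2 : M 1 1 * p - M 0 1 * q = l2 * p.
  have : M 1 0 * xi2 0 0 + M 1 1 * xi2 1 0 = l2 * xi2 1 0 by rewrite -mulmx2E E2 mxE.
  rewrite symM x0 x1 => /(congr1 ( *%R delta)) h.
  transitivity (delta * delta * (M 1 1 * p - M 0 1 * q)); first by rewrite delta2 mul1r.
  transitivity (delta * delta * (l2 * p)); last by rewrite delta2 mul1r.
  transitivity (delta * (M 0 1 * - (delta * q) + M 1 1 * (delta * p))); first by ring.
  by rewrite h; ring.
split.
- rewrite -[LHS]mulr1 -pq1.
  transitivity (p * (M 0 0 * p + M 0 1 * q) - q * (M 0 1 * p - M 0 0 * q)); first by ring.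
  by rewrite a1 b1; ring.
- rewrite -[LHS]mulr1 -pq1.
  transitivity (q * (M 0 0 * p + M 0 1 * q) + p * (M 0 1 * p - M 0 0 * q)); first by ring.
  by rewrite a1 b1; ring.
- rewrite -[LHS]mulr1 -pq1.
  transitivity (q * (M 0 1 * p + M 1 1 * q) + p * (M 1 1 * p - M 0 1 * q)); first by ring.
  by rewrite a2 b2; ring.
Qed.

Let innerE2 u : inner u u = alpha u ^+ 2 + beta u ^+ 2.
Proof. by rewrite innerE -[LHS]mul1r -pq1 /alpha /beta; ring. Qed.

Let strainE u : strain_form M u = l1 * alpha u ^+ 2 + l2 * beta u ^+ 2.
Proof. by rewrite /strain_form; have [-> -> ->] := entries; rewrite /alpha /beta; ring. Qed.

Let shear_formE u : shear_form M u = (l1 - l2) * (alpha u * beta u).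
Proof. by rewrite /shear_form; have [-> -> ->] := entries; rewrite /alpha /beta; ring. Qed.

Lemma strain_form_gt0 u : u != 0 -> 0 < strain_form M u.
Proof.
move=> /inner_gt0; rewrite innerE2 strainE; move: l12 => /andP[h1 h2] h.
apply: lt_le_trans (mulr_gt0 h1 h) _.
by rewrite mulrDr lerD2l ler_wpM2r // sqr_ge0.
Qed.

(* Negative along the first eigendirection of A and positive along the second;
   unlike the eigenvectors it depends continuously on A. *)
Definition discriminator (A : 'M[R]_2) (u : 'cV[R]_2) : R :=
  2 * strain_form A u - (A 0 0 + A 1 1) * inner u u.

Let discE u : discriminator M u = (l1 - l2) * (alpha u ^+ 2 - beta u ^+ 2).
Proof.
rewrite /discriminator strainE innerE2.
have -> : M 0 0 + M 1 1 = (l1 + l2) * (p * p + q * q).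
  by have [-> _ ->] := entries; ring.
by rewrite pq1; ring.
Qed.

(** One of [alpha u] and [beta u] vanishes and the other does not, so [alpha^2 - beta^2] is plus or
    minus [<u, u>]. *)
Lemma discriminator_neq0 u : u != 0 -> l1 != l2 -> shear_form M u = 0 ->
  discriminator M u != 0.
Proof.
move=> u0 l0; rewrite shear_formE discE => /eqP ab.
rewrite !mulf_eq0 subr_eq0 (negbTE l0) /= in ab.
rewrite mulf_neq0 ?subr_eq0 //.
have := inner_gt0 u0; rewrite innerE2; case/orP: ab => /eqP ->; rewrite expr0n /=.
  by rewrite add0r => h; rewrite lt_eqF.
by rewrite addr0 => h; rewrite gt_eqF.
Qed.

(** Since [l1 - l2 < 0], the sign of the discriminator tells which of [alpha u] and [beta u] is
    larger in absolute value; the other one is zero. *)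
Lemma shearless_parallel u : l1 != l2 -> shear_form M u = 0 ->
  (discriminator M u < 0 -> exists c, u = c *: xi1) /\
  (0 < discriminator M u -> exists c, u = c *: xi2).
Proof.
move=> l0; rewrite shear_formE discE => /eqP ab.
rewrite !mulf_eq0 subr_eq0 (negbTE l0) /= in ab.
have l12' : l1 - l2 < 0 by rewrite subr_lt0 lt_neqAle l0; case/andP: l12.
have e0 : u 0 0 = p * alpha u + q * beta u.
  by rewrite -[LHS]mul1r -pq1 /alpha /beta; ring.
have e1 : u 1 0 = q * alpha u - p * beta u.
  by rewrite -[LHS]mul1r -pq1 /alpha /beta; ring.
split.
  rewrite nmulr_rlt0 // subr_gt0 => h.
  have b0 : beta u = 0.
    by case/orP: ab => /eqP a0; [move: h; rewrite a0 expr0n ltNge sqr_ge0|].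
  exists (alpha u); apply/colP; apply: ord2P; rewrite !mxE ?e0 ?e1 b0 -/p -/q; ring.
rewrite nmulr_rgt0 // subr_lt0 => h.
have a0 : alpha u = 0.
  by case/orP: ab => /eqP b0; [|move: h; rewrite b0 expr0n ltNge sqr_ge0].
have [x0 x1] := xi2E.
exists (- (delta * beta u)); apply/colP; apply: ord2P; rewrite !mxE ?e0 ?e1 a0 ?x0 ?x1.
  by transitivity (delta * delta * (q * beta u)); [rewrite delta2|]; ring.
by transitivity (delta * delta * - (p * beta u)); [rewrite delta2|]; ring.
Qed.

End Spectral.

(** * Curves *)

Section Curves.
Context {R : realType}.

Lemma is_derive_curve_comp (r : R -> 'cV[R]_2) (psi : R -> R) (t m : R) (l : 'cV[R]_2) :
  is_derive (psi t) 1 r l -> is_derive t 1 psi m -> is_derive t 1 (r \o psi) (m *: l).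
Proof.
move=> /is_derive_mxP dr dpsi; apply/is_derive_mxP => i j; rewrite mxE mulrC.
exact: is_derive1_comp (dr i j) dpsi.
Qed.

Lemma is_derive_gradP (L : 'cV[R]_2 -> 'cV[R]_2 -> R) (r v : R -> 'cV[R]_2)
    (g : 'cV[R]_2 -> R) (s : R) (x : 'cV[R]_2) :
  is_derive s 1 (fun t => grad (L (r t)) (v t)) (grad g x) <->
  forall i, is_derive s 1 (fun t => 'D_(basis_vec R i) (L (r t)) (v t))
    ('D_(basis_vec R i) g x).
Proof.
split=> [/is_derive_mxP h i|h].
  have := h i 0; rewrite mxE.
  by under [X in is_derive _ _ X _]funext do rewrite mxE.
apply/is_derive_mxP => i j; rewrite mxE.
by under [X in is_derive _ _ X _]funext do rewrite mxE.
Qed.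

(* At an endpoint of the segment only one side of s is available, which is
   enough because the two-sided derivative is assumed to exist. *)
Lemma is_derive_vanishing (h : R -> R) (a b s l : R) : a < b ->
  (forall t, a <= t <= b -> h t = 0) -> a <= s <= b -> is_derive s 1 h l -> l = 0.
Proof.
move=> ab h0 sab [d1 d2].
have hs : h s = 0 by exact: h0.
apply/eqP/negPn/negP => l0.
have {}d1 : (fun t => t^-1 *: ((h \o shift s) (t *: 1) - h s)) @ (0 : R)^' --> l.
  by rewrite -d2.
have /cvgrPdist_lt/(_ `|l|) := d1; rewrite normr_gt0 => /(_ l0).
move=> /nbhs_ballP[e /= e0 he].
(* A step of length [d] to the side with more room stays in [[a, b]]. The difference quotient there
   is 0, at distance [|l|] from [l], although it should be closer. *)
pose d := Num.min (e / 2) ((b - a) / 2).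
have d0 : 0 < d by rewrite /d lt_min !divr_gt0 // subr_gt0.
have de : d < e by rewrite /d gt_min ltr_pdivrMr // ltr_pMr // ltr1n.
have dab : d <= (b - a) / 2 by rewrite /d ge_min lexx orbT.
have [t [t0 te tab]] : exists t : R, [/\ t != 0, `|t| < e & a <= t + s <= b].
  have [sm|sm] := leP s ((a + b) / 2).
    by exists d; split; [rewrite gt_eqF|rewrite gtr0_norm|lra].
  by exists (- d); split; [rewrite oppr_eq0 gt_eqF|rewrite normrN gtr0_norm|lra].
have bt : ball (0 : R) e t by rewrite /ball /= sub0r normrN.
have := he t bt t0; rewrite /= [t%:A]mulr1.
by rewrite (h0 _ tab) hs subrr scaler0 subr0 ltxx.
Qed.

Lemma open_segment_margin (B : set R) (sigma : R) : open B -> 0 <= sigma ->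
  `[0, sigma]%classic `<=` B ->
  exists2 e : R, 0 < e & `]- e, sigma + e[%classic `<=` B.
Proof.
move=> oB s0 sB.
have B0 : B 0 by apply: sB; rewrite /= in_itv /= lexx.
have Bs : B sigma by apply: sB; rewrite /= in_itv /= lexx s0.
have /nbhs_ballP[e1 /= e10 h1] := open_nbhs_nbhs (conj oB B0).
have /nbhs_ballP[e2 /= e20 h2] := open_nbhs_nbhs (conj oB Bs).
exists (Num.min e1 e2); first by rewrite lt_min e10.
move=> s; rewrite /= in_itv /= => /andP[ha hb].
have [m1 m2] : Num.min e1 e2 <= e1 /\ Num.min e1 e2 <= e2.
  by rewrite !ge_min !lexx orbT.
have [sn|sp] := ltP s 0.
  by apply: h1; rewrite /ball /= sub0r normrN ltr0_norm //; lra.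
have [ss|ss] := leP s sigma; first by apply: sB; rewrite /= in_itv /= sp.
by apply: h2; rewrite /ball /= distrC gtr0_norm ?subr_gt0 //; lra.
Qed.

(** Two opposite signs on the interval would force a zero by the intermediate value theorem. *)
Lemma continuous_sign (q : R -> R) (A I : set R) : is_interval I -> open A -> I `<=` A ->
  (forall s, A s -> {for s, continuous q}) -> (forall s, I s -> q s != 0) ->
  (forall s, I s -> q s < 0) \/ (forall s, I s -> 0 < q s).
Proof.
move=> itvI oA IA cq q0.
have [hneg|/existsNP[s /not_implyP[Is /negP sn]]] :=
  pselect (forall s, I s -> q s < 0); first by left.
right=> t It; rewrite lt0r q0 //= leNgt; apply/negP => tn.
have {}sn : 0 < q s by rewrite lt0r q0 // leNgt.
have cw x y : I x -> I y -> {within `[x, y], continuous q}.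
  move=> Ix Iy; apply: continuous_in_subspaceT => z; rewrite inE /= in_itv /= => hz.
  by apply: cq; apply: IA; exact: itvI hz.
have [z Iz z0] : exists2 z, I z & q z = 0.
  have [st|ts] := leP s t.
    have [||z] := @IVT R q s t 0 st.
    - exact: cw.
    - by rewrite ge_min le_max (ltW sn) (ltW tn) orbT.
    by rewrite in_itv /= => hz z0; exists z => //; exact: itvI hz.
  have [||z] := @IVT R q t s 0 (ltW ts).
  - exact: cw.
  - by rewrite ge_min le_max (ltW sn) (ltW tn) orbT.
  by rewrite in_itv /= => hz z0; exists z => //; exact: itvI hz.
by have := q0 z Iz; rewrite z0 eqxx.
Qed.

(** * Regularity of the quadratic forms along a curve *)

Section FormsAlongCurve.
Variables (n : nat) (J : set R) (M : R -> 'M[R]_2) (u v : R -> 'cV[R]_2).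
Hypotheses (oJ : open J) (CM : forall i j, Ck n J (fun s => M s i j)).
Hypotheses (Cu : forall i, Ck n J (fun s => u s i 0)) (Cv : forall i, Ck n J (fun s => v s i 0)).

Local Ltac Ck_polynomial :=
  do ?[exact: CM | exact: Cu | exact: Cv | exact: Ck_cst
      | apply: (CkB oJ) | apply: (CkD oJ) | apply: (CkM oJ)].

Lemma Ck_shear_form : Ck n J (fun s => shear_form (M s) (u s)).
Proof. by rewrite /shear_form; Ck_polynomial. Qed.

Lemma Ck_strain_form : Ck n J (fun s => strain_form (M s) (u s)).
Proof. by rewrite /strain_form; Ck_polynomial. Qed.

Lemma Ck_strain_polar : Ck n J (fun s => strain_polar (M s) (u s) (v s)).
Proof. by rewrite /strain_polar; Ck_polynomial. Qed.

Lemma Ck_inner : Ck n J (fun s => inner (u s) (v s)).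
Proof. by rewrite (funext (fun s => innerE (u s) (v s))); Ck_polynomial. Qed.

End FormsAlongCurve.

Lemma Ck_discriminator n (J : set R) (M : R -> 'M[R]_2) (u : R -> 'cV[R]_2) :
  open J -> (forall i j, Ck n J (fun s => M s i j)) ->
  (forall i, Ck n J (fun s => u s i 0)) -> Ck n J (fun s => discriminator (M s) (u s)).
Proof.
move=> oJ CM Cu; rewrite /discriminator; apply: CkB => //.
  by apply: CkZ => //; exact: Ck_strain_form.
by apply: CkM => //; [exact: CkD|exact: Ck_inner].
Qed.

End Curves.

(** * Regularity of the Cauchy--Green tensor *)

Section Barriers.
Context {R : realType}.
Variables (U : set 'cV[R]_2) (F : 'cV[R]_2 -> 'cV[R]_2).
Hypotheses (openU : open U) (smoothF : smooth_on U F).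
Let C := cauchy_green F.

Lemma cauchy_greenE x i j : C x i j =
  'D_(basis_vec R i) (fun y => F y 0 0) x * 'D_(basis_vec R j) (fun y => F y 0 0) x +
  'D_(basis_vec R i) (fun y => F y 1 0) x * 'D_(basis_vec R j) (fun y => F y 1 0) x.
Proof. by rewrite /C /cauchy_green mulmx2E !mxE. Qed.

Lemma cauchy_green_sym x : C x 1 0 = C x 0 1.
Proof. by rewrite !cauchy_greenE [X in X + _]mulrC [X in _ + X]mulrC. Qed.

Lemma smooth_jac k i : smooth_on U (fun x => 'D_(basis_vec R i) (fun y => F y k 0) x).
Proof. by apply: smooth_on_derive => n; apply: Ck_coord openU _. Qed.

Lemma derivable_cauchy_green i j x v : U x -> derivable (fun y => C y i j) x v.
Proof.
move=> Ux; rewrite (funext (fun y => cauchy_greenE y i j)).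
by apply: derivableD; apply: derivableM; apply: smooth_on_derivable Ux; exact: smooth_jac.
Qed.

(** The chain rule is applied to the partial derivatives of [F], so that only one-variable sums and
    products remain. *)
Lemma Ck_cauchy_green n (B : set R) (r : R -> 'cV[R]_2) i j : open B ->
  (forall s, B s -> U (r s)) -> smooth_on B r -> Ck n B (fun s => C (r s) i j).
Proof.
move=> oB rU sr.
rewrite (funext (fun s => cauchy_greenE (r s) i j)).
have h k l : Ck n B (fun s => 'D_(basis_vec R l) (fun y => F y k 0) (r s)).
  exact: (Ck_plane_comp n openU oB rU (smooth_jac k l) sr).
by apply: CkD => //; apply: CkM.
Qed.

End Barriers.

(** * Shearless curves and null geodesics *)

Section Geodesics.
Context {R : realType}.
Variables (U : set 'cV[R]_2) (F : 'cV[R]_2 -> 'cV[R]_2).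
Variables (lambda1 lambda2 : 'cV[R]_2 -> R) (xi1 xi2 : 'cV[R]_2 -> 'cV[R]_2).
Hypotheses (openU : open U) (smoothF : smooth_on U F).
Hypothesis eigenC : eigen_data (cauchy_green F) U lambda1 lambda2 xi1 xi2.
Local Notation C := (cauchy_green F).
Local Notation symC := (cauchy_green_sym F).

(** Lying in [U] and having nonzero velocity are open conditions, so they persist on a margin around
    the segment. *)
Lemma regular_curve_extension sigma r : regular_curve U sigma r ->
  exists e : R, [/\ 0 < e, smooth_on `]- e, sigma + e[%classic r &
    forall s, - e < s < sigma + e -> U (r s) /\ 'D_1 r s != 0].
Proof.
move=> [s0 [B [oB sB sr]] Ur].
pose B' := [set s | B s /\ (U (r s) /\ 'D_1 r s != 0)].
have oB' : open B'.
  rewrite openE => s [Bs [Us ns]]; rewrite /interior.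
  have c1 : {for s, continuous r} by exact: smooth_on_continuous sr Bs.
  have c2 : {for s, continuous (fun t => 'D_1 r t)}.
    exact: smooth_on_continuous (@smooth_on_derive R R _ B r 1 sr) Bs.
  apply: filterI; first exact: open_nbhs_nbhs.
  apply: filterI; first by apply: c1; exact: open_nbhs_nbhs.
  exact: (cvgr_neq0 _ c2 ns).
have sB' : `[0, sigma]%classic `<=` B'.
  by move=> s hs; split; [exact: sB|rewrite -derive1E; exact: Ur].
have [e e0 eB] := open_segment_margin oB' (ltW s0) sB'.
exists e; split => //.
  by move=> n; apply: Ck_subset (sr n) => s /eB[].
by move=> s hs; have [] : B' s by apply: eB; rewrite /= in_itv.
Qed.

Lemma strain_form_pos x u : U x -> u != 0 -> 0 < strain_form (C x) u.
Proof.
move=> /eigenC[l12 e1 e2 [n1 n2 n12]] u0.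
exact: (strain_form_gt0 (symC x) l12 e1 e2 n1 n2 n12 u0).
Qed.

(** The eigenvectors need not vary continuously with the point; it is the constant sign of the
    discriminator that selects one family on all of [I]. *)
Lemma shearless_tensorlines sigma r : regular_curve U sigma r ->
  (forall s, `[0, sigma]%classic s -> shear_form (C (r s)) ('D_1 r s) = 0) ->
  composed_of_tensorlines lambda1 lambda2 xi1 xi2 sigma r.
Proof.
move=> reg h0 I itvI Isub lne.
have [e [e0 sr Ur]] := regular_curve_extension reg.
pose J : set R := `]- e, sigma + e[%classic.
have oJ : open J by exact: interval_open.
have JE s : J s -> - e < s < sigma + e by rewrite /J /= in_itv.
have IJ : I `<=` J.
  by move=> s /Isub; rewrite /J /= !in_itv /=; lra.
have rU s : J s -> U (r s) by move=> /JE /Ur[].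
have u0 s : J s -> 'D_1 r s != 0 by move=> /JE /Ur[].
have cC i j : Ck 0 J (fun s => C (r s) i j) := Ck_cauchy_green openU smoothF 0 i j oJ rU sr.
have cu i : Ck 0 J (fun s => 'D_1 r s i 0).
  have s1 : smooth_on J (fun s : R => 'D_1 r s) := @smooth_on_derive R R _ J r 1 sr.
  exact: (Ck_coord i 0 oJ (s1 0%N)).
pose q s := discriminator (C (r s)) ('D_1 r s).
have := @continuous_sign _ q J I itvI oJ IJ (Ck_discriminator oJ cC cu).
case.
- move=> s Is; have Us := rU _ (IJ _ Is).
  have [l12 e1 e2 [n1 n2 n12]] := eigenC Us.
  apply: (discriminator_neq0 (symC _) e1 e2 n1 n2 n12); [exact: u0 (IJ _ Is)|exact: lne|].
  exact: h0 (Isub _ Is).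
- move=> qn; left=> s Is; have Us := rU _ (IJ _ Is).
  have [l12 e1 e2 [n1 n2 n12]] := eigenC Us; rewrite derive1E.
  have [h _] := shearless_parallel (symC _) l12 e1 e2 n1 n2 n12 (lne _ Is) (h0 _ (Isub _ Is)).
  exact: h (qn _ Is).
- move=> qp; right=> s Is; have Us := rU _ (IJ _ Is).
  have [l12 e1 e2 [n1 n2 n12]] := eigenC Us; rewrite derive1E.
  have [_ h] := shearless_parallel (symC _) l12 e1 e2 n1 n2 n12 (lne _ Is) (h0 _ (Isub _ Is)).
  exact: h (qp _ Is).
Qed.

(** A change of parameter multiplies the shear form by [psi'^2], which is nonzero, so nullity passes
    back to [r]. *)
Lemma null_geodesic_tensorlines sigma r : null_geodesic C U sigma r ->
  composed_of_tensorlines lambda1 lambda2 xi1 xi2 sigma r.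
Proof.
move=> [reg [a [b [psi [[ab [A [oA abA spsi]] psi0 psiE] _ null]]]]].
apply: shearless_tensorlines => // s hs.
have [t ht tE] : (psi @` `[a, b]%classic) s by rewrite psiE.
have [e [e0 sr Ur]] := regular_curve_extension reg.
have dr : is_derive (psi t) 1 r ('D_1 r (psi t)).
  apply/derivableP; rewrite tE; apply: (@smooth_on_derivable _ _ _ _ r s 1 sr).
  by move: hs; rewrite /= !in_itv /=; lra.
have dpsi : is_derive t 1 psi ('D_1 psi t).
  by apply/derivableP; apply: (@smooth_on_derivable _ _ _ _ psi t 1 spsi); exact: abA.
have [_ E] := is_derive_curve_comp dr dpsi.
have := null t ht; rewrite (metric_lagrangianE symC) derive1E E shear_formZ /= tE => /eqP.
by rewrite mulf_eq0 expf_eq0 /= -derive1E (negbTE (psi0 t ht)) => /eqP.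
Qed.

Lemma derivable_shear_form_position (x u v : 'cV[R]_2) : U x ->
  derivable (fun y => shear_form (C y) u) x v.
Proof.
move=> Ux; have d i j := @derivable_cauchy_green _ _ _ openU smoothF i j x v Ux.
rewrite /shear_form; apply: derivableD; apply: derivableM.
- exact: (d 0 1).
- exact: derivable_cst.
- by apply: derivableB; [exact: (d 1 1)|exact: (d 0 0)].
- exact: derivable_cst.
Qed.

Lemma derivable_strain_form_position (x u v : 'cV[R]_2) : U x ->
  derivable (fun y => strain_form (C y) u) x v.
Proof.
move=> Ux; have d i j := @derivable_cauchy_green _ _ _ openU smoothF i j x v Ux.
rewrite /strain_form; apply: derivableD; first apply: derivableD; apply: derivableM.
- exact: (d 0 0).
- exact: derivable_cst.
- exact: derivable_cst.
- by apply: derivableM; [exact: (d 0 1)|exact: derivable_cst].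
- exact: (d 1 1).
- exact: derivable_cst.
Qed.

(** [speed] is the product under the root in the shear, [dspeed] its derivative in the velocity, and
    [slope] the derivative of [1 / sqrt]. *)
Let speed (x u : 'cV[R]_2) := strain_form (C x) u * inner u u.
Let dspeed (x u v : 'cV[R]_2) :=
  strain_form (C x) u * (2 * inner u v) + inner u u * strain_polar (C x) u v.
Let slope (y : R) := - ((Num.sqrt y)^-1 * (Num.sqrt y)^-1 * (2 * Num.sqrt y)^-1).

Let speed_gt0 x u : U x -> u != 0 -> 0 < speed x u.
Proof. by move=> Ux u0; rewrite mulr_gt0 ?inner_gt0 // strain_form_pos. Qed.

Lemma is_derive_shear_velocity (x u v : 'cV[R]_2) : U x -> u != 0 ->
  is_derive u v (shear C x)
    (shear_polar (C x) u v * (Num.sqrt (speed x u))^-1 +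
     shear_form (C x) u * (slope (speed x u) * dspeed x u v)).
Proof.
move=> Ux u0.
rewrite (funext (fun w => shearE symC x w)).
have d1 := is_derive_shear_form (C x) u v.
have d2 : is_derive u v (speed x) (dspeed x u v).
  exact: is_deriveM (is_derive_strain_form (C x) u v) (is_derive_inner u v).
have d3 := is_derive_comp_dir (is_derive_inv_sqrt (speed_gt0 Ux u0)) d2.
apply: is_derive_eq (is_deriveM d1 d3) _.
by rewrite addrC; congr (_ + _); exact: mulrC.
Qed.

(** The derivative of the denominator comes multiplied by the shear form, which is zero at [u]. *)
Lemma derive_shear_position (x u v : 'cV[R]_2) : U x -> u != 0 ->
  shear_form (C x) u = 0 ->
  'D_v (fun y => shear C y u) x =
    'D_v (fun y => shear_form (C y) u) x * (Num.sqrt (speed x u))^-1.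
Proof.
move=> Ux u0 h0.
rewrite (funext (fun y => shearE symC y u)).
have d1 := derivableP (@derivable_shear_form_position x u v Ux).
have d2 : derivable (fun y => speed y u) x v.
  by apply: derivableM; [exact: derivable_strain_form_position|exact: derivable_cst].
have d3 := @is_derive_comp_dir _ _ _ (fun y => speed y u) x v _ _
  (is_derive_inv_sqrt (speed_gt0 Ux u0)) (derivableP d2).
have [_ ->] := is_deriveM d1 d3.
by rewrite h0 scale0r add0r; exact: mulrC.
Qed.

Lemma barrier_null_geodesic sigma r :
  perfect_shearless_barrier C U sigma r -> null_geodesic C U sigma r.
Proof.
move=> [reg EL null]; split => //.
have [s0 _ _] := reg.
have [e [e0 sr Ur]] := regular_curve_extension reg.
pose J : set R := `]- e, sigma + e[%classic.
have oJ : open J by exact: interval_open.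
have JE s : J s -> - e < s < sigma + e by rewrite /J /= in_itv.
have IJ s : `[0, sigma]%classic s -> J s by rewrite /J /= !in_itv /=; lra.
have rU s : J s -> U (r s) by move=> /JE /Ur[].
have u0 s : J s -> 'D_1 r s != 0 by move=> /JE /Ur[].
have cC n i j : Ck n J (fun s => C (r s) i j) := Ck_cauchy_green openU smoothF n i j oJ rU sr.
have cu n i : Ck n J (fun s => 'D_1 r s i 0).
  have s1 : smooth_on J (fun s : R => 'D_1 r s) := @smooth_on_derive R R _ J r 1 sr.
  exact: (Ck_coord i 0 oJ (s1 n)).
pose u s := 'D_1 r s.
pose N s := speed (r s) (u s).
pose G s := Num.sqrt (N s).
pose h s := shear_form (C (r s)) (u s).
have CN n : Ck n J N :=
  CkM oJ (Ck_strain_form oJ (cC n) (cu n)) (Ck_inner oJ (cu n) (cu n)).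
have N0 s : J s -> 0 < N s by move=> Js; exact: speed_gt0 (rU _ Js) (u0 _ Js).
have CG n : Ck n J G := Ck_sqrt oJ N0 (CN n).
have G0 s : J s -> 0 < G s by move=> Js; rewrite sqrtr_gt0 N0.
have h0 s : `[0, sigma]%classic s -> h s = 0.
  move=> hs; have := null s hs; rewrite (shearE symC) derive1E => /eqP.
  rewrite mulf_eq0 invr_eq0 => /orP[/eqP //|/eqP E].
  by have := G0 _ (IJ _ hs); rewrite /G /N /speed E ltxx.
(* The momentum of the shear along the curve is [P i + h * K i], and [X i] is the position
   derivative of the shear form alone. *)
pose P i s := shear_polar (C (r s)) (u s) (basis_vec R i) * (G s)^-1.
pose K i s := slope (N s) * dspeed (r s) (u s) (basis_vec R i).
pose X i s := 'D_(basis_vec R i) (fun x => shear_form (C x) (u s)) (r s).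
(* Both [h] and its derivative vanish on [[0, sigma]] and [K i] is derivable, so [h * K i] has
   derivative 0 there and [P i] inherits the derivative of the momentum. *)
have dP i s : `[0, sigma]%classic s -> is_derive s 1 (P i) (X i s * (G s)^-1).
  move=> hs; have Js := IJ s hs.
  have /is_derive_gradP/(_ i) := EL s hs.
  rewrite derive1E (derive_shear_position _ (rU _ Js) (u0 _ Js) (h0 _ hs)).
  rewrite -/(X i s) -/(G s) => dM.
  have dM' : is_derive s 1 (fun t => P i t + h t * K i t) (X i s * (G s)^-1).
    apply: near_eq_is_derive dM.
    apply: filterS (open_nbhs_nbhs (conj oJ Js)) => t Jt.
    rewrite derive1E.
    by have [_ ->] := is_derive_shear_velocity (basis_vec R i) (rU _ Jt) (u0 _ Jt).
  have CK : Ck 1 J (K i).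
    have cb j : Ck 1 J (fun s : R => basis_vec R i j 0) by exact: Ck_cst.
    have c1 : Ck 1 J (fun s => strain_form (C (r s)) (u s)) := Ck_strain_form oJ (cC 1) (cu 1).
    have c2 : Ck 1 J (fun s => 2 * inner (u s) (basis_vec R i)) :=
      CkZ 2 oJ (Ck_inner oJ (cu 1) cb).
    have c3 : Ck 1 J (fun s => inner (u s) (u s)) := Ck_inner oJ (cu 1) (cu 1).
    have c4 : Ck 1 J (fun s => strain_polar (C (r s)) (u s) (basis_vec R i)) :=
      Ck_strain_polar oJ (cC 1) (cu 1) cb.
    have c5 : Ck 1 J (fun s => (G s)^-1).
      by apply: (Ck_inv oJ _ (CG 1)) => t /G0 /gt_eqF ->.
    have c6 : Ck 1 J (fun s => (2 * G s)^-1).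
      apply: (Ck_inv oJ _ (CkZ 2 oJ (CG 1))) => t /G0 /gt_eqF g.
      by rewrite mulf_neq0 ?pnatr_eq0 ?g.
    have c7 : Ck 1 J (fun s => slope (N s)).
      apply: Ck_ext oJ _ (CkZ (-1) oJ (CkM oJ (CkM oJ c5 c5) c6)) => t _.
      by rewrite mulN1r.
    exact: (CkM oJ c7 (CkD oJ (CkM oJ c1 c2) (CkM oJ c3 c4))).
  have Ch : Ck 1 J h := Ck_shear_form oJ (cC 1) (cu 1).
  have dh := CkS_is_derive Ch Js.
  (* [h] is known to vanish on the closed segment only, so at its endpoints this rests on a
     one-sided argument. *)
  have l0 : 'D_1 h s = 0.
    apply: (is_derive_vanishing s0 _ _ dh).
    - by move=> t ht; apply: h0; rewrite /= in_itv.
    - by move: hs; rewrite /= in_itv.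
  rewrite l0 in dh.
  have dhK := is_deriveM dh (CkS_is_derive CK Js).
  have := is_deriveB dM' dhK.
  rewrite (_ : (fun t => P i t + h t * K i t) - h * K i = P i); last first.
    by apply/funext => t; rewrite /GRing.add /= /GRing.opp /= addrK.
  move=> dPi; apply: is_derive_eq dPi _.
  by rewrite h0 // scale0r scaler0 addr0 subr0.
(* With [psi' = 1 / G(psi)] the velocity of [r \o psi] is [u / G] taken at [psi], so the momentum of
   the metric Lagrangian along it is [P i \o psi]. *)
have [a [b [psi [J' [rep oJ' abJ' dpsi]]]]] := time_change s0 e0 (fun x hx => G0 x hx) CG.
have [_ _ _ psiE] := rep.
have psiI t : `[a, b]%classic t -> `[0, sigma]%classic (psi t).
  by move=> ht; rewrite -psiE; exists t.
have JP t : J' t -> J (psi t) by move=> /dpsi[]; rewrite /J /= in_itv.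
have Dr t : J' t -> 'D_1 (r \o psi) t = (G (psi t))^-1 *: u (psi t).
  move=> Jt; have [_ dp] := dpsi t Jt.
  have dr : is_derive (psi t) 1 r (u (psi t)).
    by apply/derivableP; exact: smooth_on_derivable sr (JP _ Jt).
  by have [_ ->] := is_derive_curve_comp dr dp.
exists a, b, psi; split => // t ht; last first.
  rewrite (metric_lagrangianE symC) derive1E (Dr _ (abJ' _ ht)) shear_formZ /=.
  by rewrite -/(h (psi t)) (h0 _ (psiI _ ht)) mulr0.
have Jt := abJ' _ ht; have [_ dpt] := dpsi t Jt.
apply/is_derive_gradP => i.
(* One factor [1 / G] comes from [dP], the other from [psi']. Together they match the position
   derivative of the metric Lagrangian, which is quadratic in the velocity [u / G]. *)
have dPpsi := is_derive1_comp (dP i _ (psiI _ ht)) dpt.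
apply: (@near_eq_is_derive _ _ _ (P i \o psi)).
  apply: filterS (open_nbhs_nbhs (conj oJ' Jt)) => t' Jt'.
  rewrite derive1E (Dr _ Jt') /=.
  rewrite (funext (fun w => metric_lagrangianE symC (r (psi t')) w)).
  have [_ ->] := is_derive_shear_form (C (r (psi t'))) ((G (psi t'))^-1 *: u (psi t'))
    (basis_vec R i).
  by rewrite shear_polarZ.
apply: is_derive_eq dPpsi _.
rewrite derive1E (Dr _ Jt) /=.
rewrite (funext (fun x => metric_lagrangianE symC x ((G (psi t))^-1 *: u (psi t)))).
rewrite (funext (fun x => shear_formZ (C x) (G (psi t))^-1 (u (psi t)))).
have Upt : U (r (psi t)) by exact: rU (JP _ Jt).
have dX := @derivable_shear_form_position _ (u (psi t)) (basis_vec R i) Upt.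
rewrite (deriveZ ((G (psi t))^-1 ^+ 2) dX) -/(X i (psi t)) [RHS]mulrC expr2.
by rewrite mulrA.
Qed.

End Geodesics.

Unset Implicit Arguments.
Set Strict Implicit.

Theorem theorem1 (R : realType)
    (W : set (R * 'cV[R]_2)%type) (v : R -> 'cV[R]_2 -> 'cV[R]_2) (t0 t : R)
    (U : set 'cV[R]_2) (F : 'cV[R]_2 -> 'cV[R]_2)
    (lambda1 lambda2 : 'cV[R]_2 -> R) (xi1 xi2 : 'cV[R]_2 -> 'cV[R]_2)
    (openW : open W)
    (smooth_v : smooth_on W (fun z : (R * 'cV[R]_2)%type => v z.1 z.2))
    (openU : open U)
    (flowF : is_flow_map W v t0 t U F)
    (smoothF : smooth_on U F)
    (eigenC : eigen_data (cauchy_green F) U lambda1 lambda2 xi1 xi2) :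
  (forall (sigma : R) (r : R -> 'cV[R]_2),
     perfect_shearless_barrier (cauchy_green F) U sigma r ->
     null_geodesic (cauchy_green F) U sigma r) /\
  (forall (sigma : R) (r : R -> 'cV[R]_2),
     null_geodesic (cauchy_green F) U sigma r ->
     composed_of_tensorlines lambda1 lambda2 xi1 xi2 sigma r) /\
  (forall (sigma : R) (r : R -> 'cV[R]_2),
     perfect_shearless_barrier (cauchy_green F) U sigma r ->
     composed_of_tensorlines lambda1 lambda2 xi1 xi2 sigma r).
Proof.
have barrier sigma r := @barrier_null_geodesic R U F _ _ _ _ openU smoothF eigenC sigma r.
have geodesic sigma r := @null_geodesic_tensorlines R U F _ _ _ _ openU smoothF eigenC sigma r.
by split=> //; split=> // sigma r /barrier /geodesic.
Qed.
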